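(* Let $X$ be a real Banach space. Then the pre-annihilator of $Lip_0^{ph}(X)$ in $F(X)$ is $${}^{\perp}Lip_0^{ph}(X)=\overline{\operatorname{span}}^{\|\cdot\|}\{ r\delta_x-\delta_{rx} : r\ge 0,\ x\in X\},$$ where the closed span is taken in $F(X)$.
   Context: $Lip_0(X)$ is the Banach space of all Lipschitz functions $f:X\to\mathbb{R}$ with $f(0)=0$, with norm $Lip(f)=\sup_{x\neq y}\frac{|f(x)-f(y)|}{\|x-y\|}$. $Lip_0^{ph}(X)=\{f\in Lip_0(X): f(\alpha x)=\alpha f(x)\ \forall \alpha\ge 0,\ x\in X\}$. For $x\in X$, $\delta_x\in Lip_0(X)^*$ is the evaluation functional $\delta_x(f)=f(x)$. The Lipschitz-free space is $F(X)=\overline{\operatorname{span}}^{\|\cdot\|}\{\delta_x : x\in X\}\subset Lip_0(X)^*$, and $F(X)^*$ is identified with $Lip_0(X)$ through the pairing $(\gamma,f)\mapsto\gamma(f)$. The pre-annihilator is ${}^{\perp}Lip_0^{ph}(X)=\{\gamma\in F(X):\gamma(f)=0\ \forall f\in Lip_0^{ph}(X)\}$. *)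

(* Defs.v *)
From HB Require Import structures.
From mathcomp Require Import all_boot all_order all_algebra.
From mathcomp Require Import all_classical all_reals topology normedtype.

Set Implicit Arguments.
Unset Strict Implicit.
Unset Printing Implicit Defensive.

Import Order.TTheory GRing.Theory Num.Theory.
Import numFieldNormedType.Exports.

Local Open Scope classical_set_scope.
Local Open Scope ring_scope.

Section closed_span.
Context {R : realType} {V : normedModType R}.
Implicit Types (A : set V) (v : V).

Definition lspan A : set V :=
  [set v | exists n (a : 'I_n -> R) (u : 'I_n -> V),
     (forall i, A (u i)) /\ v = \sum_(i < n) a i *: u i].

Definition closed_lspan A : set V := closure (lspan A).

Lemma closure_normP A v :
  closure A v <-> forall e : R, 0 < e -> exists2 w, A w & `|v - w| < e.
Proof.
split=> [Av e e0|Av B].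
  have [w [Aw]] := Av _ (nbhsx_ballx v e e0).
  by rewrite -ball_normE; exists w.
rewrite -nbhs_ballE => -[e /= e0 veB].
have [w Aw vw] := Av e e0.
by exists w; split=> //; apply: veB; rewrite -ball_normE.
Qed.

Lemma subset_lspan A : A `<=` lspan A.
Proof.
move=> v Av; exists 1%N, (fun=> 1), (fun=> v); split=> //.
by rewrite big_ord1 scale1r.
Qed.

Lemma lspan0 A : lspan A 0.
Proof.
exists 0%N, (fun=> 0), (fun=> 0); split; first by case.
by rewrite big_ord0.
Qed.

Lemma lspanP A (a : R) (u v : V) : lspan A u -> lspan A v -> lspan A (a *: u + v).
Proof.
move=> [m [b [x [Ax ->]]]] [n [c [y [Ay ->]]]].
exists (m + n)%N,
  (fun i => match fintype.split i with inl j => a * b j | inr j => c j end),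
  (fun i => match fintype.split i with inl j => x j | inr j => y j end).
split=> [i|]; first by case: (fintype.split i).
rewrite big_split_ord scaler_sumr /=; congr +%R; apply: eq_bigr => i _.
  case: splitP => j /=; first by move=> /val_inj <-; rewrite scalerA.
  by move=> ij; have := ltn_ord i; rewrite ij ltnNge leq_addr.
case: splitP => j /=; last by move=> /addnI /val_inj <-.
by move=> ij; have := ltn_ord j; rewrite -ij ltnNge leq_addr.
Qed.

Lemma subset_closed_lspan A : A `<=` closed_lspan A.
Proof. by move=> v /subset_lspan; exact: subset_closure. Qed.

Lemma closed_lspan0 A : closed_lspan A 0.
Proof. by apply: subset_closure; exact: lspan0. Qed.

Lemma closed_lspanP A (a : R) (u v : V) :
  closed_lspan A u -> closed_lspan A v -> closed_lspan A (a *: u + v).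
Proof.
move=> /closure_normP Au /closure_normP Av; apply/closure_normP => e e0.
have a0 : 0 < `|a| + 1 by rewrite ltr_wpDl.
have [|u' Au' uu'] := Au (e / 2 / (`|a| + 1)).
  by rewrite !divr_gt0.
have [|v' Av' vv'] := Av (e / 2); first by rewrite divr_gt0.
exists (a *: u' + v'); first exact: lspanP.
rewrite opprD addrACA -scalerBr (le_lt_trans (ler_normD _ _))//.
rewrite [ltRHS]splitr ltr_leD// ?(ltW vv')// normrZ.
rewrite (@le_lt_trans _ _ ((`|a| + 1) * `|u - u'|))//.
  by rewrite ler_wpM2r// lerDl.
by rewrite mulrC -ltr_pdivlMr.
Qed.

End closed_span.

Section dual.
Context {R : realType} (V : normedModType R).

Definition dual_pred : {pred V -> R} :=
  fun g => `[< linear g /\ continuous g >].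

Record dual := Dual {
  dual_fun :> V -> R;
  dual_funP : dual_fun \in dual_pred }.

HB.instance Definition _ := [isSub for dual_fun].
HB.instance Definition _ := [Choice of dual by <:].

Lemma dual_submod_closed : submod_closed dual_pred.
Proof.
split=> [|a f g /asboolP[lf cf] /asboolP[lg cg]]; apply/asboolP; split.
- by move=> a x y /=; rewrite scaler0 addr0.
- exact: cst_continuous.
- move=> b x y; rewrite !fctE lf lg.
  rewrite !scalerDr !scalerA addrACA; congr (_ + _ + _).
  by rewrite mulrC.
- move=> x; apply: (@cvgD _ _ _ _ _ (a \*: f) g) (cg x).
  exact: cvgZr (cf x).
Qed.

HB.instance Definition _ :=
  GRing.isSubmodClosed.Build R (V -> R) dual_pred dual_submod_closed.
HB.instance Definition _ := [SubChoice_isSubLmodule of dual by <:].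

Lemma dual_is_linear (g : dual) : linear (g : V -> R).
Proof. by have /asboolP[] := dual_funP g. Qed.

HB.instance Definition _ (g : dual) :=
  GRing.isLinear.Build R V R _ (g : V -> R) (dual_is_linear g).

Lemma dual_continuous (g : dual) : continuous (g : V -> R).
Proof. by have /asboolP[] := dual_funP g. Qed.

Definition dual_norm (g : dual) : R := sup [set `|g v| | v in [set v | `|v| <= 1]].

Lemma has_sup_dual_norm (g : dual) :
  has_sup [set `|g v| | v in [set v : V | `|v| <= 1]].
Proof.
split; first by exists `|g 0|, 0 => //=; rewrite normr0.
have /linear_bounded_continuous/bounded_funP/(_ 1)[M gM] := @dual_continuous g.
by exists M => _ [v /= v1 <-]; exact: gM.
Qed.

Lemma dual_normP (g : dual) (v : V) : `|g v| <= dual_norm g * `|v|.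
Proof.
have [->|v0] := eqVneq v 0; first by rewrite linear0 !normr0 mulr0.
have nv0 : 0 < `|v| by rewrite normr_gt0.
rewrite -ler_pdivrMr//; apply: ub_le_sup; first by case: (has_sup_dual_norm g).
exists (`|v|^-1 *: v) => /=.
  by rewrite normrZ normfV normr_id mulVf ?gt_eqF.
by rewrite linearZ /= normrM normfV normr_id mulrC.
Qed.

Lemma dual_norm_ge0 (g : dual) : 0 <= dual_norm g.
Proof.
apply: (@le_trans _ _ `|g 0|) => //; apply: ub_le_sup.
  by case: (has_sup_dual_norm g).
by exists 0 => //=; rewrite normr0.
Qed.

Lemma dual_norm_le (g : dual) (M : R) :
  (forall v : V, `|v| <= 1 -> `|g v| <= M) -> dual_norm g <= M.
Proof.
move=> gM; apply: ge_sup; first by case: (has_sup_dual_norm g).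
by move=> _ [v v1 <-]; exact: gM.
Qed.

Lemma dual_normD (f g : dual) : dual_norm (f + g) <= dual_norm f + dual_norm g.
Proof.
apply: dual_norm_le => v v1.
rewrite (le_trans (ler_normD _ _))// lerD//.
  by rewrite (le_trans (dual_normP f v))// ler_piMr// dual_norm_ge0.
by rewrite (le_trans (dual_normP g v))// ler_piMr// dual_norm_ge0.
Qed.

Lemma dual_normZ_le (a : R) (g : dual) : dual_norm (a *: g) <= `|a| * dual_norm g.
Proof.
apply: dual_norm_le => v v1; rewrite [leLHS]normrM ler_wpM2l//.
by rewrite (le_trans (dual_normP g v))// ler_piMr// dual_norm_ge0.
Qed.

Lemma dual_normZ (a : R) (g : dual) : dual_norm (a *: g) = `|a| * dual_norm g.
Proof.
apply/eqP; rewrite eq_le dual_normZ_le/=.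
have [->|a0] := eqVneq a 0; first by rewrite normr0 mul0r dual_norm_ge0.
rewrite -ler_pdivlMl ?normr_gt0// -normfV.
by rewrite -{1}[g]scale1r -(mulVf a0) -scalerA dual_normZ_le.
Qed.

Lemma dual_norm0_eq0 (g : dual) : dual_norm g = 0 -> g = 0.
Proof.
move=> g0; apply/val_inj/funext => v /=; apply/eqP.
by rewrite -normr_le0 (le_trans (dual_normP g v))// g0 mul0r.
Qed.

HB.instance Definition _ :=
  Lmodule_isNormed.Build R dual dual_normD dual_normZ dual_norm0_eq0.

End dual.

Arguments dual_pred {R} V.

Section lip0.
Context {R : realType} (X : normedModType R).

Definition lip0_pred : {pred X -> R} :=
  fun f => `[< f 0 = 0 /\ lipschitz f >].

Record lip0 := Lip0 {
  lip0_fun :> X -> R;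
  lip0_funP : lip0_fun \in lip0_pred }.

HB.instance Definition _ := [isSub for lip0_fun].
HB.instance Definition _ := [Choice of lip0 by <:].

Lemma lipschitzP (f : X -> R) :
  lipschitz f <-> exists k : R, forall x y, `|f x - f y| <= k * `|x - y|.
Proof.
split=> [/pinfty_ex_gt0[k _ fk]|[k fk]].
  by exists k => x y; exact: (fk (x, y)).
apply: (@klipschitzW _ _ _ k); first exact: (@globally_properfilter _ _ (0, 0)).
by move=> [x y] _; exact: fk.
Qed.

Lemma lip0_submod_closed : submod_closed lip0_pred.
Proof.
split=> [|a f g /asboolP[f0 /lipschitzP[k fk]] /asboolP[g0 /lipschitzP[l gl]]].
  apply/asboolP; split=> //; apply/lipschitzP; exists 0 => x y.
  by rewrite subrr normr0 mul0r.
apply/asboolP; split; first by rewrite !fctE f0 g0 scaler0 addr0.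
apply/lipschitzP; exists (`|a| * k + l) => x y; rewrite !fctE.
rewrite opprD addrACA -scalerBr (le_trans (ler_normD _ _))// mulrDl lerD//.
by rewrite normrZ -mulrA ler_wpM2l.
Qed.

HB.instance Definition _ :=
  GRing.isSubmodClosed.Build R (X -> R) lip0_pred lip0_submod_closed.
HB.instance Definition _ := [SubChoice_isSubLmodule of lip0 by <:].

Lemma lip0_at0 (f : lip0) : f 0 = 0.
Proof. by have /asboolP[] := lip0_funP f. Qed.

Lemma lip0_lipschitz (f : lip0) : lipschitz f.
Proof. by have /asboolP[] := lip0_funP f. Qed.

(* When [X] is trivial the set of slopes is empty, and [sup set0 = 0]. *)
Definition lip0_norm (f : lip0) : R :=
  sup [set `|f p.1 - f p.2| / `|p.1 - p.2| | p in [set p : X * X | p.1 <> p.2]].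

Lemma lip0_normP (f : lip0) (x y : X) : `|f x - f y| <= lip0_norm f * `|x - y|.
Proof.
have [->|xy] := eqVneq x y; first by rewrite !subrr !normr0 mulr0.
rewrite -ler_pdivrMr ?normr_gt0 ?subr_eq0//; apply: ub_le_sup.
  have /lipschitzP[k fk] := @lip0_lipschitz f.
  exists k => _ [[u v] /= /eqP uv <-].
  by rewrite ler_pdivrMr ?normr_gt0 ?subr_eq0.
by exists (x, y) => //=; exact/eqP.
Qed.

Lemma lip0_norm_ge0 (f : lip0) : 0 <= lip0_norm f.
Proof.
rewrite /lip0_norm; set S := (X in sup X).
have [->|/set0P[_ [[x y] /= xy _]]] := eqVneq S set0; first by rewrite sup0.
have := lip0_normP f x y; rewrite leNgt; apply: contraNT; rewrite -ltNge => f0.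
by rewrite (@lt_le_trans _ _ 0)// nmulr_rlt0// normr_gt0 subr_eq0; exact/eqP.
Qed.

Lemma lip0_norm_le (f : lip0) (k : R) : 0 <= k ->
  (forall x y, `|f x - f y| <= k * `|x - y|) -> lip0_norm f <= k.
Proof.
move=> k0 fk; rewrite /lip0_norm; set S := (X in sup X).
have [->|/set0P S0] := eqVneq S set0; first by rewrite sup0.
apply: ge_sup => // _ [[u v] /= /eqP uv <-].
by rewrite ler_pdivrMr ?normr_gt0 ?subr_eq0.
Qed.

Lemma lip0_normD (f g : lip0) : lip0_norm (f + g) <= lip0_norm f + lip0_norm g.
Proof.
apply: lip0_norm_le => [|x y]; first by rewrite addr_ge0 ?lip0_norm_ge0.
rewrite mulrDl [X in `|X|](_ : _ = (f x - f y) + (g x - g y)); last first.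
  by rewrite /= opprD addrACA.
by rewrite (le_trans (ler_normD _ _))// lerD// lip0_normP.
Qed.

Lemma lip0_normZ_le (a : R) (f : lip0) : lip0_norm (a *: f) <= `|a| * lip0_norm f.
Proof.
apply: lip0_norm_le => [|x y]; first by rewrite mulr_ge0 ?lip0_norm_ge0.
rewrite [X in `|X|](_ : _ = a * (f x - f y)); last by rewrite mulrBr.
by rewrite normrM -mulrA ler_wpM2l// lip0_normP.
Qed.

Lemma lip0_normZ (a : R) (f : lip0) : lip0_norm (a *: f) = `|a| * lip0_norm f.
Proof.
apply/eqP; rewrite eq_le lip0_normZ_le/=.
have [->|a0] := eqVneq a 0; first by rewrite normr0 mul0r lip0_norm_ge0.
rewrite -ler_pdivlMl ?normr_gt0// -normfV.
by rewrite -{1}[f]scale1r -(mulVf a0) -scalerA lip0_normZ_le.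
Qed.

Lemma lip0_norm0_eq0 (f : lip0) : lip0_norm f = 0 -> f = 0.
Proof.
move=> f0; apply/val_inj/funext => x /=; apply/eqP.
rewrite -normr_le0; have := lip0_normP f x 0.
by rewrite f0 mul0r lip0_at0 subr0.
Qed.

HB.instance Definition _ :=
  Lmodule_isNormed.Build R lip0 lip0_normD lip0_normZ lip0_norm0_eq0.

Definition lip0_ph : set lip0 :=
  [set f | forall (a : R) (x : X), 0 <= a -> f (a *: x) = a * f x].

Lemma evaluation_subproof (x : X) : (fun f : lip0 => f x) \in dual_pred lip0.
Proof.
apply/asboolP; split; first by [].
pose ev (f : lip0) : R := f x.
have ev_lin : linear ev by [].
pose evL : {linear lip0 -> R} :=
  HB.pack ev (GRing.isLinear.Build R lip0 R _ ev ev_lin).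
apply: (@bounded_linear_continuous _ _ _ evL); apply/bounded_funP => r.
exists (r * `|x|) => f fr; have := lip0_normP f x 0.
rewrite lip0_at0 !subr0 => /le_trans; apply.
by rewrite ler_wpM2r.
Qed.

Definition evaluation (x : X) : dual lip0 := Dual (evaluation_subproof x).

End lip0.

Section lipschitz_free.
Context {R : realType} (X : normedModType R).

Definition lipfree_pred : {pred dual (lip0 X)} :=
  fun g => `[< closed_lspan (range (@evaluation R X)) g >].

Record lipfree := LipFree {
  lipfree_dual :> dual (lip0 X);
  lipfree_dualP : lipfree_dual \in lipfree_pred }.

HB.instance Definition _ := [isSub for lipfree_dual].
HB.instance Definition _ := [Choice of lipfree by <:].

Lemma lipfree_submod_closed : submod_closed lipfree_pred.
Proof.
split=> [|a f g /asboolP Ff /asboolP Fg]; apply/asboolP.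
  exact: closed_lspan0.
exact: closed_lspanP.
Qed.

HB.instance Definition _ :=
  GRing.isSubmodClosed.Build R (dual (lip0 X)) lipfree_pred
    lipfree_submod_closed.
HB.instance Definition _ := [SubChoice_isSubLmodule of lipfree by <:].

Definition lipfree_norm (g : lipfree) : R := `|g : dual (lip0 X)|.

Lemma lipfree_normD (f g : lipfree) :
  lipfree_norm (f + g) <= lipfree_norm f + lipfree_norm g.
Proof. exact: ler_normD. Qed.

Lemma lipfree_normZ (a : R) (g : lipfree) :
  lipfree_norm (a *: g) = `|a| * lipfree_norm g.
Proof. exact: normrZ. Qed.

Lemma lipfree_norm0_eq0 (g : lipfree) : lipfree_norm g = 0 -> g = 0.
Proof. by move=> /normr0_eq0 g0; exact: val_inj. Qed.

HB.instance Definition _ :=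
  Lmodule_isNormed.Build R lipfree lipfree_normD lipfree_normZ
    lipfree_norm0_eq0.

Lemma delta_subproof (x : X) : evaluation x \in lipfree_pred.
Proof. by apply/asboolP; apply: subset_closed_lspan; exists x. Qed.

Definition delta (x : X) : lipfree := LipFree (delta_subproof x).

Definition preannihilator (S : set (lip0 X)) : set lipfree :=
  [set g | forall f, S f -> g f = 0].

End lipschitz_free.

Arguments lip0_ph {R} X.

(* Main.v *)
Require Import Defs.
From HB Require Import structures.
From mathcomp Require Import all_boot all_order all_algebra.
From mathcomp Require Import all_classical all_reals topology normedtype.
From mathcomp Require Import lra.

Set Implicit Arguments.
Unset Strict Implicit.
Unset Printing Implicit Defensive.

Import Order.TTheory GRing.Theory Num.Theory.
Import numFieldNormedType.Exports.

Local Open Scope classical_set_scope.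
Local Open Scope ring_scope.

(* By Hahn-Banach, a [g] outside the closed span of the elements
   [r *: delta x - delta (r *: x)] is separated from it by a continuous linear
   functional [phi] vanishing on these elements. Since [x |-> delta x] is
   nonexpansive, [f x := phi (delta x)] is Lipschitz; it is positively
   homogeneous because [phi] kills the generators, and [phi] is evaluation at
   [f] by density, so [g f <> 0].

   Hahn-Banach itself is obtained without extending partial functionals: Zorn's
   lemma yields a minimal sublinear functional, and minimality forces linearity
   because [sublinear_shift q v] is sublinear and at most [q] for every [v]. *)

(** * Sublinear functionals and the Hahn-Banach theorem *)

Section sublinear.
Context {R : realType} {V : lmodType R}.
Implicit Types (p q : V -> R) (x y v : V).

(** Homogeneity is only an inequality, which is easier to check for infima; [sublinearZ] recovers
    equality by using [a^-1]. *)
Definition sublinear p :=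
  (forall x y, p (x + y) <= p x + p y) /\
  (forall (a : R) x, 0 <= a -> p (a *: x) <= a * p x).

Lemma sublinear0 p : sublinear p -> p 0 = 0.
Proof.
move=> [pD pZ]; apply/eqP; rewrite eq_le; apply/andP; split.
  by have := pZ 0 0 (lexx _); rewrite scaler0 mul0r.
by have := pD 0 0; rewrite addr0; lra.
Qed.

Lemma sublinear_oppr p x : sublinear p -> - p (- x) <= p x.
Proof.
move=> sp; have := sublinear0 sp; rewrite -(subrr x).
by have := sp.1 x (- x); lra.
Qed.

Lemma sublinearZ p (a : R) x : sublinear p -> 0 <= a -> p (a *: x) = a * p x.
Proof.
move=> sp; rewrite le_eqVlt => /predU1P[<-|a0].
  by rewrite scale0r mul0r sublinear0.
apply/eqP; rewrite eq_le sp.2 ?(ltW a0)//=.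
rewrite -ler_pdivlMl//; have := sp.2 a^-1 (a *: x).
by rewrite scalerA mulVf ?gt_eqF// scale1r; apply; rewrite invr_ge0 ltW.
Qed.

(** Serves three infima: the shift, the infimum of a chain, the distance to a span. One index [k]
    only has to dominate the pair [i], [j], so chains are covered as well as indices that add up. *)
Lemma inf_sublinear (I : Type) (D : set I) (F : V -> I -> R) :
  D !=set0 -> (forall x, has_lbound (F x @` D)) ->
  (forall x y i j, D i -> D j ->
     exists2 k, D k & F (x + y) k <= F x i + F y j) ->
  (forall (a : R) x i, 0 <= a -> D i ->
     exists2 k, D k & F (a *: x) k <= a * F x i) ->
  sublinear (fun x => inf (F x @` D)).
Proof.
move=> [i0 Di0] lbF FD FZ.
have F0 x : (F x @` D) !=set0 by exists (F x i0), i0.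
have infF x i : D i -> inf (F x @` D) <= F x i.
  by move=> Di; apply: ge_inf => //; exists i.
split=> [x y|a x].
  rewrite -lerBlDr; apply: lb_le_inf => // _ [i Di <-].
  rewrite lerBlDr [leRHS]addrC -lerBlDr; apply: lb_le_inf => // _ [j Dj <-].
  rewrite lerBlDr [leRHS]addrC; have [k Dk] := FD x y i j Di Dj.
  exact/le_trans/infF.
move=> a0; have le i : D i -> inf (F (a *: x) @` D) <= a * F x i.
  by move=> Di; have [k Dk] := FZ a x i a0 Di; exact/le_trans/infF.
move: a0; rewrite le_eqVlt => /predU1P[a0|a0].
  by rewrite -[a in a * _]a0 mul0r (le_trans (le _ Di0))// -a0 mul0r.
rewrite -ler_pdivrMl//; apply: lb_le_inf => // _ [i Di <-].
by rewrite ler_pdivrMl// le.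
Qed.

(* The largest sublinear functional below [p] taking the value [- p v] at
   [- v]. *)
Definition sublinear_shift p v x : R :=
  inf [set p (x + t *: v) - t * p v | t in [set t : R | 0 <= t]].

Lemma sublinear_shift_lbound p v x : sublinear p ->
  lbound [set p (x + t *: v) - t * p v | t in [set t : R | 0 <= t]]
    (- p (- x)).
Proof.
move=> sp _ [t /= t0 <-].
have := sp.1 (x + t *: v) (- x); rewrite addrC addKr sublinearZ//; lra.
Qed.

Lemma sublinear_shift_le p v x (t : R) : sublinear p -> 0 <= t ->
  sublinear_shift p v x <= p (x + t *: v) - t * p v.
Proof.
move=> sp t0; apply: ge_inf; last by exists t.
by exists (- p (- x)); exact: sublinear_shift_lbound.
Qed.

Lemma sublinear_shiftP p v : sublinear p -> sublinear (sublinear_shift p v).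
Proof.
move=> sp; apply: inf_sublinear.
- by exists 0 => /=.
- by move=> x; exists (- p (- x)); exact: sublinear_shift_lbound.
- move=> x y s t /= s0 t0; exists (s + t); first exact: addr_ge0.
  have := sp.1 (x + s *: v) (y + t *: v).
  by rewrite addrACA -scalerDl; lra.
- move=> a x t /= a0 t0; exists (a * t); first exact: mulr_ge0.
  have := sp.2 a (x + t *: v) a0.
  by rewrite scalerDr scalerA; lra.
Qed.

Lemma sublinear_shift_lep p v x : sublinear p -> sublinear_shift p v x <= p x.
Proof.
move=> sp; have := @sublinear_shift_le p v x 0 sp (lexx _).
by rewrite scale0r mul0r addr0 subr0.
Qed.

Lemma minimal_sublinear_linear q : sublinear q ->
  (forall q', sublinear q' -> (forall x, q' x <= q x) -> q' = q) -> linear q.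
Proof.
move=> sq qmin.
have shiftE v : sublinear_shift q v = q.
  by apply: qmin => [|x]; [exact: sublinear_shiftP|exact: sublinear_shift_lep].
have qD x y : q (x + y) = q x + q y.
  apply/eqP; rewrite eq_le sq.1/= -lerBrDr.
  (* The term [t = 1] of the infimum gives [q x <= q (x + y) - q y], the missing superadditivity. *)
  have := @sublinear_shift_le q y x 1 sq ler01.
  by rewrite shiftE scale1r mul1r.
have qN x : q (- x) = - q x.
  by apply/eqP; rewrite -addr_eq0 -qD addNr sublinear0.
move=> a x y; rewrite qD; congr (_ + _).
have [a0|a0] := leP 0 a; first exact: sublinearZ.
rewrite -[a]opprK scaleNr qN sublinearZ ?oppr_ge0 1?ltW//.
by rewrite [RHS]mulNr.
Qed.

Lemma exists_minimal_sublinear p : sublinear p ->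
  exists q, [/\ sublinear q, forall x, q x <= p x &
    forall q', sublinear q' -> (forall x, q' x <= q x) -> q' = q].
Proof.
move=> sp; pose T := {q : V -> R | sublinear q /\ forall x, q x <= p x}.
(* The order is reversed, so that Zorn's maximal element is a minimal functional. *)
pose ge_fun : rel T := fun s t => `[< forall x, sval t x <= sval s x >].
have [|||A Atot|[q [sq qp]] qmin] := @Zorn T ge_fun.
- by move=> q; apply/asboolP.
- move=> q r s /asboolP rq /asboolP sr; apply/asboolP => x.
  exact: le_trans (sr x) (rq x).
- move=> [q ?] [r ?] /asboolP /= rq /asboolP /= qr; apply: eq_exist.
  by apply/funext => x; apply/eqP; rewrite eq_le rq qr.
(* The empty chain is bounded by [p] itself; the infimum [m] below would be the default value 0
   there. *)
- have [->|/set0P A0] := eqVneq A set0.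
    by exists (exist _ p (conj sp (fun x => lexx _))).
  have lbA x : lbound [set sval r x | r in A] (- p (- x)).
    move=> _ [[r [sr rp]] /= _ <-].
    by rewrite (le_trans _ (sublinear_oppr x sr))// lerN2.
  pose m x := inf [set sval r x | r in A].
  have mA r x : A r -> m x <= sval r x.
    by move=> Ar; apply: ge_inf; [exists (- p (- x)); exact: lbA|exists r].
  have sm : sublinear m.
    apply: inf_sublinear => // [x|x y r s Ar As|a x r a0 Ar].
    + by exists (- p (- x)).
    + have [/asboolP|/asboolP] := Atot _ _ Ar As => [sr|rs].
        exists s => //; rewrite (le_trans ((svalP s).1.1 x y))//.
        by rewrite lerD2r.
      exists r => //; rewrite (le_trans ((svalP r).1.1 x y))//.
      by rewrite lerD2l.
    + by exists r => //; exact: (svalP r).1.2.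
  have mp x : m x <= p x.
    by have [r Ar] := A0; exact: le_trans (mA r x Ar) ((svalP r).2 x).
  exists (exist _ m (conj sm mp)) => r Ar.
  by apply/asboolP => x; exact: mA.
- exists q; split=> // r sr rq.
  have rp x : r x <= p x := le_trans (rq x) (qp x).
  have := qmin (exist _ r (conj sr rp)).
  by move=> /(_ _)/(congr1 sval); apply; apply/asboolP.
Qed.

(** Minimizing below [sublinear_shift p v] instead of [p] forces [f (- v) <= - p v], hence
    [p v <= f v]. *)
Lemma hahn_banach p v : sublinear p ->
  exists f : V -> R, [/\ linear f, forall x, f x <= p x & f v = p v].
Proof.
move=> sp; have [f [sf fp fmin]] :=
  exists_minimal_sublinear (sublinear_shiftP v sp).
have lf := minimal_sublinear_linear sf fmin.
have lefp x : f x <= p x.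
  exact: le_trans (fp x) (sublinear_shift_lep v x sp).
exists f; split=> //; apply/eqP; rewrite eq_le lefp/=.
have := le_trans (fp (- v)) (@sublinear_shift_le p v (- v) 1 sp ler01).
rewrite scale1r mul1r addNr sublinear0// sub0r.
by have := sublinear_oppr v sf; lra.
Qed.

End sublinear.

(** * Separation from a closed span *)

Section closed_span.
Context {R : realType} {V : normedModType R}.
Implicit Types (A P : set V) (u v w : V).

Lemma lspan_ind A P : P 0 ->
  (forall (a : R) u v, A u -> P v -> P (a *: u + v)) -> lspan A `<=` P.
Proof.
move=> P0 PD _ [n [a [u [Au ->]]]]; elim/big_rec : _ => // i v _.
exact: PD.
Qed.

Definition lspan_dist A v : R := inf [set `|v - w| | w in lspan A].

Lemma lspan_dist_le A v w : lspan A w -> lspan_dist A v <= `|v - w|.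
Proof.
move=> Aw; apply: ge_inf; last by exists w.
by exists 0 => _ [u _ <-].
Qed.

Lemma lspan_dist_sublinear A : sublinear (lspan_dist A).
Proof.
apply: inf_sublinear => [|v|v w v' w' Av' Aw'|a v v' a0 Av'].
- by exists 0; exact: lspan0.
- by exists 0 => _ [u _ <-].
- exists (v' + w'); first by rewrite -[v']scale1r; exact: lspanP.
  by rewrite opprD addrACA ler_normD.
- exists (a *: v'); first by rewrite -[_ *: _]addr0; exact/lspanP/lspan0.
  by rewrite -scalerBr normrZ ger0_norm.
Qed.

(** Hahn-Banach is applied to the distance to the span: it is at most the norm, vanishes on [A], and
    is nonzero at [v]. *)
Lemma hahn_banach_separation A v : ~ closed_lspan A v ->
  exists f : V -> R, [/\ linear f, forall x, `|f x| <= `|x|,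
    forall u, A u -> f u = 0 & f v != 0].
Proof.
move=> Av; have sd := lspan_dist_sublinear A.
have [f [lf fd fv]] := hahn_banach v sd.
have fN x : f (- x) = - f x.
  pose F : {linear V -> R} := HB.pack f (GRing.isLinear.Build R V R _ f lf).
  exact: (linearN F).
have dist_norm x : lspan_dist A x <= `|x|.
  by have := lspan_dist_le x (lspan0 A); rewrite subr0.
have dist0 x : lspan A x -> lspan_dist A x <= 0.
  by move=> /(lspan_dist_le x); rewrite subrr normr0.
exists f; split=> // [x|u Au|].
- rewrite ler_norml (le_trans (fd x))// andbT.
  by rewrite lerNl -fN -normrN (le_trans (fd _)).
- have Au1 := subset_lspan Au.
  have ANu : lspan A (- u).
    by rewrite -scaleN1r -[_ *: _]addr0; apply/lspanP/lspan0.
  apply/eqP; rewrite eq_le (le_trans (fd u)) ?dist0//=.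
  by rewrite -oppr_le0 -fN (le_trans (fd _)) ?dist0.
- apply/eqP => fv0; apply: Av; apply/closure_normP => e e0.
  have [|_ [w Aw <-] we] := @inf_adherent _ [set `|v - w| | w in lspan A] _ e0.
    split; first by exists `|v - 0|, 0 => //; exact: lspan0.
    by exists 0 => _ [u _ <-].
  exists w => //; move: we; rewrite -[inf _]/(lspan_dist A v) -fv fv0.
  by rewrite add0r.
Qed.

End closed_span.

(** * Duality between the Lipschitz-free space and [lip0 X] *)

Section lipschitz_free.
Context {R : realType} (X : normedModType R).
Implicit Types (g h : lipfree X) (f : lip0 X) (x y : X).

Lemma lipfree_normP g f : `|g f| <= `|g| * `|f|.
Proof. exact: dual_normP. Qed.

Lemma delta_norm_le x y : `|delta x - delta y| <= `|x - y|.
Proof.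
apply: dual_norm_le => f f1; rewrite (le_trans (lip0_normP f x y))//.
by rewrite ler_piMl.
Qed.

(** The closure defining [lipfree X] is taken in the dual of [lip0 X], so approximants live there;
    [P] carries whatever is needed of them, such as coming from [lipfree X]. *)
Lemma lipfree_approx g (P : dual (lip0 X) -> Prop) : P 0 ->
  (forall (a : R) x (d : dual (lip0 X)), P d -> P (a *: evaluation x + d)) ->
  forall e : R, 0 < e ->
    exists2 d : dual (lip0 X), P d & `|(g : dual (lip0 X)) - d| < e.
Proof.
move=> P0 PD e e0.
have /asboolP/closure_normP/(_ e e0)[d Ad gd] := lipfree_dualP g.
exists d => //; move: Ad; apply: lspan_ind => // a _ d' [x _ <-].
exact: PD.
Qed.

Lemma lipfree_functionalP (phi : lipfree X -> R) : linear phi ->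
  (forall g, `|phi g| <= `|g|) ->
  exists f : lip0 X, forall g, phi g = g f.
Proof.
move=> lphi phi_le.
pose Phi : {linear lipfree X -> R} :=
  HB.pack phi (GRing.isLinear.Build R (lipfree X) R _ phi lphi).
have phiB g h : phi (g - h) = phi g - phi h := linearB Phi g h.
have phi_lip : (fun x => phi (delta x)) \in @lip0_pred R X.
  apply/asboolP; split.
    suff -> : delta (0 : X) = 0 by exact: (linear0 Phi).
    by apply/val_inj/val_inj/funext => f; exact: lip0_at0.
  apply/lipschitzP; exists 1 => x y; rewrite -phiB mul1r.
  exact: le_trans (phi_le _) (delta_norm_le x y).
pose f := Lip0 phi_lip.
exists f => g; apply/eqP; rewrite -subr_eq0 -normr_le0.
apply/ler_addgt0Pr => e e0; rewrite add0r.
have f1 : 0 < 1 + `|f| by rewrite ltr_pwDl.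
(* The tolerance comes from [|phi (g - h)| + |(g - h) f| <= |g - h| * (1 + |f|)]. *)
have [||_ [h -> hf] gh] := @lipfree_approx g
  (fun d => exists2 h : lipfree X, d = h & phi h = h f) _ _
  (e / (1 + `|f|)) (divr_gt0 e0 f1).
- by exists 0 => //; exact: (linear0 Phi).
- move=> a x _ [h -> hf]; exists (a *: delta x + h) => //.
  by rewrite lphi hf.
- have -> : phi g - g f = phi (g - h) - (g - h) f.
    by rewrite phiB hf [(g - h) f]/(g f - h f) opprB addrA subrK.
  rewrite (le_trans (ler_normB _ _))//.
  rewrite (le_trans (lerD (phi_le _) (lipfree_normP _ _)))//.
  rewrite -[X in X + _]mulr1 -mulrDr -ler_pdivlMr//.
  exact: ltW gh.
Qed.

(** Evaluation at each [f] in [S] is linear and bounded by [|f|], so its kernel is a closed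
    subspace. *)
Lemma closed_lspan_preannihilator (A : set (lipfree X)) (S : set (lip0 X)) :
  A `<=` preannihilator S -> closed_lspan A `<=` preannihilator S.
Proof.
move=> AS g /closure_normP Ag f Sf.
have lspanS : lspan A `<=` preannihilator S.
  apply: lspan_ind => // a u v Au Sv h Sh.
  have -> : (a *: u + v) h = a * u h + v h by [].
  by rewrite (AS _ Au)// (Sv _ Sh) mulr0 addr0.
apply/eqP; rewrite -normr_le0; apply/ler_addgt0Pr => e e0; rewrite add0r.
(* Adding 1 keeps the divisor positive when [f = 0]. *)
have f1 : 0 < 1 + `|f| by rewrite ltr_pwDl.
have [h Ah gh] := Ag (e / (1 + `|f|)) (divr_gt0 e0 f1).
have -> : g f = (g - h) f.
  have -> : (g - h) f = g f - h f by [].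
  by rewrite (lspanS _ Ah)// subr0.
rewrite (le_trans (lipfree_normP _ _))//.
rewrite (@le_trans _ _ (`|g - h| * (1 + `|f|)))//.
  by rewrite ler_wpM2l// lerDr.
by rewrite -ler_pdivlMr// ltW.
Qed.

End lipschitz_free.

Theorem proposition3p2 (R : realType) (X : completeNormedModType R) :
  preannihilator (lip0_ph X) =
  closed_lspan [set g : lipfree X | exists (r : R) (x : X),
                  0 <= r /\ g = r *: delta x - delta (r *: x)].
Proof.
apply/seteqP; split=> [g gph|].
  apply: contrapT => /hahn_banach_separation[phi [lphi phi_le phi0 /eqP]].
  have [f phif] := lipfree_functionalP lphi phi_le.
  (* As [g] kills [lip0_ph X], only the homogeneity of [f] remains: [phi] vanishing on a generator
     reads [r * f x - f (r *: x) = 0]. *)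
  apply; rewrite phif; apply: gph => r x r0.
  have /phi0 : exists (s : R) (y : X),
    0 <= s /\ r *: delta x - delta (r *: x) = s *: delta y - delta (s *: y).
    by exists r, x.
  by rewrite phif => /subr0_eq.
apply: closed_lspan_preannihilator => _ [r [x [r0 ->]]] f fph.
by apply/eqP; rewrite subr_eq0; apply/eqP/esym/fph.
Qed.
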